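(* Let $(\,)_0:Grd\to Set$ be the forgetful functor (a fibration) associating with any groupoid its set of objects. For every set $X$, the fibre $Grd_X$ is locally algebraically cartesian closed.
   Context: $Grd$ is the category of (small) groupoids and functors. $Grd_X$ is the category whose objects are the groupoids whose set of objects is $X$, and whose morphisms are the functors between such groupoids which are the identity on objects (the fibre of $(\,)_0$ above $X$). For a finitely complete category $\mathbb C$ and an object $Y$, $Pt_Y\mathbb C$ has as objects the pairs $(f:X\to Y,\ s:Y\to X)$ with $fs=1_Y$, and as morphisms the maps over $Y$ commuting with the sections. For $h:X\to Y$, $h^*:Pt_Y\mathbb C\to Pt_X\mathbb C$ is the change of base functor given by pulling back along $h$. A morphism $h$ is algebraically exponentiable when $h^*$ admits a right adjoint. $\mathbb C$ is locally algebraically cartesian closed when every morphism of $\mathbb C$ is algebraically exponentiable. *)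

(* Defs.v *)
From Stdlib Require Import ProofIrrelevance.

Set Implicit Arguments.
Unset Strict Implicit.
Unset Printing Implicit Defensive.

Declare Scope cat_scope.
Delimit Scope cat_scope with cat.
Local Open Scope cat_scope.

Record Category := {
  ob :> Type;
  hom : ob -> ob -> Type;
  idm : forall A, hom A A;
  comp : forall A B C, hom B C -> hom A B -> hom A C;
  comp_idl : forall A B (f : hom A B), comp (idm B) f = f;
  comp_idr : forall A B (f : hom A B), comp f (idm A) = f;
  comp_assoc : forall A B C D (h : hom C D) (g : hom B C) (f : hom A B),
    comp h (comp g f) = comp (comp h g) f
}.
Arguments hom {c} A B.
Arguments idm {c} A.
Arguments comp {c A B C} g f.

Notation "g '\oc' f" := (comp g f) (at level 40, left associativity) : cat_scope.

Record Functor (C D : Category) := {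
  fob :> C -> D;
  fmap : forall A B, hom A B -> hom (fob A) (fob B);
  fmap_id : forall A, fmap (idm A) = idm (fob A);
  fmap_comp : forall A B E (g : hom B E) (f : hom A B),
    fmap (g \oc f) = fmap g \oc fmap f
}.
Arguments fmap {C D} F {A B} f : rename.

Record Adjunction (C D : Category) (L : Functor C D) (R : Functor D C) := {
  transpose : forall (A : C) (B : D), hom (L A) B -> hom A (R B);
  untranspose : forall (A : C) (B : D), hom A (R B) -> hom (L A) B;
  transposeK : forall A B (f : hom (L A) B), untranspose (transpose f) = f;
  untransposeK : forall A B (g : hom A (R B)), transpose (untranspose g) = g;
  transpose_natural :
    forall A A' B B' (a : hom A' A) (f : hom (L A) B) (b : hom B B'),
      transpose (b \oc f \oc fmap L a) = fmap R b \oc transpose f \oc a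
}.

Definition has_right_adjoint (C D : Category) (L : Functor C D) : Prop :=
  exists R : Functor D C, inhabited (Adjunction L R).

Record Terminal (C : Category) := {
  term_ob : C;
  to_term : forall A : C, hom A term_ob;
  to_term_unique : forall (A : C) (f : hom A term_ob), f = to_term A
}.

Record Pullback (C : Category) (A B Z : C) (f : hom A Z) (g : hom B Z) := {
  pb_ob : C;
  pb_fst : hom pb_ob A;
  pb_snd : hom pb_ob B;
  pb_square : f \oc pb_fst = g \oc pb_snd;
  pb_pair : forall (Q : C) (a : hom Q A) (b : hom Q B),
    f \oc a = g \oc b -> hom Q pb_ob;
  pb_pair_fst : forall Q (a : hom Q A) (b : hom Q B) (e : f \oc a = g \oc b),
    pb_fst \oc pb_pair e = a;
  pb_pair_snd : forall Q (a : hom Q A) (b : hom Q B) (e : f \oc a = g \oc b),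
    pb_snd \oc pb_pair e = b;
  pb_ext : forall Q (u v : hom Q pb_ob),
    pb_fst \oc u = pb_fst \oc v -> pb_snd \oc u = pb_snd \oc v -> u = v
}.

Definition Pullbacks (C : Category) : Type :=
  forall (A B Z : C) (f : hom A Z) (g : hom B Z), Pullback f g.

Definition finitely_complete (C : Category) : Prop :=
  inhabited (Terminal C) /\ inhabited (Pullbacks C).

Section Points.
Variables (C : Category) (Y : C).

Record Pt_ob := {
  pt_dom : C;
  pt_map : hom pt_dom Y;
  pt_sec : hom Y pt_dom;
  pt_split : pt_map \oc pt_sec = idm Y
}.

Record Pt_hom (P Q : Pt_ob) := {
  pth :> hom (pt_dom P) (pt_dom Q);
  pth_map : pt_map Q \oc pth = pt_map P;
  pth_sec : pth \oc pt_sec P = pt_sec Q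
}.

Lemma Pt_hom_eq (P Q : Pt_ob) (u v : Pt_hom P Q) : pth u = pth v -> u = v.
Proof.
destruct u as [u u1 u2], v as [v v1 v2]; simpl; intros e; subst v.
f_equal; apply proof_irrelevance.
Qed.

Definition Pt_id (P : Pt_ob) : Pt_hom P P :=
  {| pth := idm (pt_dom P);
     pth_map := comp_idr (pt_map P);
     pth_sec := comp_idl (pt_sec P) |}.

Definition Pt_comp (P Q R : Pt_ob) (v : Pt_hom Q R) (u : Pt_hom P Q) :
  Pt_hom P R.
Proof.
refine {| pth := pth v \oc pth u |}.
- now rewrite comp_assoc, pth_map, pth_map.
- now rewrite <- comp_assoc, pth_sec, pth_sec.
Defined.

Definition Pt : Category.
Proof.
refine {| ob := Pt_ob; hom := Pt_hom; idm := Pt_id; comp := Pt_comp |}.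
- intros; apply Pt_hom_eq, comp_idl.
- intros; apply Pt_hom_eq, comp_idr.
- intros; apply Pt_hom_eq, comp_assoc.
Defined.

End Points.

Section ChangeOfBase.
Variables (C : Category) (pb : Pullbacks C) (X Y : C) (h : hom X Y).

Lemma base_change_sec_eq (P : Pt Y) :
  h \oc idm X = pt_map P \oc (pt_sec P \oc h).
Proof. now rewrite comp_assoc, pt_split, comp_idl, comp_idr. Qed.

Definition base_change_ob (P : Pt Y) : Pt X :=
  {| pt_dom := pb_ob (pb h (pt_map P));
     pt_map := pb_fst (pb h (pt_map P));
     pt_sec := pb_pair (pb h (pt_map P)) (base_change_sec_eq P);
     pt_split := pb_pair_fst (pb h (pt_map P)) (base_change_sec_eq P) |}.

Lemma base_change_hom_eq (P Q : Pt Y) (u : hom P Q) :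
  h \oc pb_fst (pb h (pt_map P)) =
  pt_map Q \oc (pth u \oc pb_snd (pb h (pt_map P))).
Proof. now rewrite comp_assoc, pth_map, pb_square. Qed.

Definition base_change_hom (P Q : Pt Y) (u : hom P Q) :
  hom (base_change_ob P) (base_change_ob Q).
Proof.
refine {| pth := pb_pair (pb h (pt_map Q)) (base_change_hom_eq u)
                 : hom (pt_dom (base_change_ob P))
                       (pt_dom (base_change_ob Q)) |}.
- apply pb_pair_fst.
- apply pb_ext; simpl; rewrite comp_assoc.
  + now rewrite !pb_pair_fst.
  + now rewrite !pb_pair_snd, <- comp_assoc, pb_pair_snd, comp_assoc, pth_sec.
Defined.

Definition base_change : Functor (Pt Y) (Pt X).
Proof.
refine {| fob := base_change_ob; fmap := base_change_hom |}.
- intros P; apply Pt_hom_eq, pb_ext; simpl.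
  + now rewrite pb_pair_fst, comp_idr.
  + now rewrite pb_pair_snd, comp_idl, comp_idr.
- intros P Q R v u; apply Pt_hom_eq, pb_ext; simpl; rewrite comp_assoc.
  + now rewrite !pb_pair_fst.
  + now rewrite !pb_pair_snd, <- !comp_assoc, pb_pair_snd.
Defined.

Definition algebraically_exponentiable : Prop := has_right_adjoint base_change.

End ChangeOfBase.

(* Change of base is defined from a choice of pullbacks; different choices give
   isomorphic functors, and the condition is required for each of them. *)
Definition locally_algebraically_cartesian_closed (C : Category) : Prop :=
  finitely_complete C /\
  forall (pb : Pullbacks C) (X Y : C) (h : hom X Y),
    algebraically_exponentiable pb h.

Section Fibre.
Variables (E B : Category) (F : Functor E B) (X : B).

Record fibre_ob := {
  fib_ob :> E;
  fib_over : F fib_ob = X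
}.

Definition eq_to_hom (A A' : B) (e : A = A') : hom A A' :=
  match e with eq_refl => idm A end.

(* [fib_hom_over] says that [F fib_hom] is [idm X] after transport along
   [F P = X] and [F Q = X]. *)
Record fibre_hom (P Q : fibre_ob) := {
  fib_hom :> hom (fib_ob P) (fib_ob Q);
  fib_hom_over : eq_to_hom (fib_over Q) \oc fmap F fib_hom
                 = eq_to_hom (fib_over P)
}.

Lemma fibre_hom_eq (P Q : fibre_ob) (u v : fibre_hom P Q) :
  fib_hom u = fib_hom v -> u = v.
Proof.
destruct u as [u u1], v as [v v1]; simpl; intros e; subst v.
f_equal; apply proof_irrelevance.
Qed.

Definition fibre_id (P : fibre_ob) : fibre_hom P P.
Proof.
refine {| fib_hom := idm (fib_ob P) |}.
now rewrite fmap_id, comp_idr.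
Defined.

Definition fibre_comp (P Q R : fibre_ob)
  (v : fibre_hom Q R) (u : fibre_hom P Q) : fibre_hom P R.
Proof.
refine {| fib_hom := fib_hom v \oc fib_hom u |}.
now rewrite fmap_comp, comp_assoc, !fib_hom_over.
Defined.

Definition fibre : Category.
Proof.
refine {| ob := fibre_ob; hom := fibre_hom;
          idm := fibre_id; comp := fibre_comp |}.
- intros; apply fibre_hom_eq, comp_idl.
- intros; apply fibre_hom_eq, comp_idr.
- intros; apply fibre_hom_eq, comp_assoc.
Defined.

End Fibre.

(* The universe of small sets: both the objects and the arrows of a small
   groupoid live in it. *)
Definition SmallSet := Type.

Definition Sets : Category :=
  {| ob := SmallSet;
     hom := fun A B => A -> B;
     idm := fun A x => x;
     comp := fun A B C g f x => g (f x);
     comp_idl := fun A B f => eq_refl;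
     comp_idr := fun A B f => eq_refl;
     comp_assoc := fun A B C D h g f => eq_refl |}.

Record Groupoid := {
  gob : SmallSet;
  garr : gob -> gob -> SmallSet;
  gid : forall x, garr x x;
  gcomp : forall x y z, garr y z -> garr x y -> garr x z;
  ginv : forall x y, garr x y -> garr y x;
  gcomp_idl : forall x y (a : garr x y), gcomp (gid y) a = a;
  gcomp_idr : forall x y (a : garr x y), gcomp a (gid x) = a;
  gcomp_assoc : forall x y z w (c : garr z w) (b : garr y z) (a : garr x y),
    gcomp c (gcomp b a) = gcomp (gcomp c b) a;
  gcomp_invl : forall x y (a : garr x y), gcomp (ginv a) a = gid x;
  gcomp_invr : forall x y (a : garr x y), gcomp a (ginv a) = gid y
}.
Arguments garr : clear implicits.
Arguments gid : clear implicits.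
Arguments gcomp {g x y z} b a : rename.
Arguments ginv {g x y} a.

Record GFunctor (G H : Groupoid) := {
  gfob : gob G -> gob H;
  gfmap : forall x y, garr G x y -> garr H (gfob x) (gfob y);
  gfmap_id : forall x, gfmap (gid G x) = gid H (gfob x);
  gfmap_comp : forall x y z (b : garr G y z) (a : garr G x y),
    gfmap (gcomp b a) = gcomp (gfmap b) (gfmap a)
}.
Arguments gfob {G H} F x : rename.
Arguments gfmap {G H} F {x y} a : rename.

Definition GFunctor_id (G : Groupoid) : GFunctor G G :=
  {| gfob := fun x => x;
     gfmap := fun x y a => a;
     gfmap_id := fun x => eq_refl;
     gfmap_comp := fun x y z b a => eq_refl |}.

Definition GFunctor_comp (G H K : Groupoid)
  (V : GFunctor H K) (U : GFunctor G H) : GFunctor G K.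
Proof.
refine {| gfob := fun x => gfob V (gfob U x);
          gfmap := fun x y a => gfmap V (gfmap U a) |}.
- intros; now rewrite !gfmap_id.
- intros; now rewrite !gfmap_comp.
Defined.

Definition Grd : Category.
Proof.
refine {| ob := Groupoid; hom := GFunctor;
          idm := GFunctor_id; comp := GFunctor_comp |}.
- intros G H [U0 U1 p q]; unfold GFunctor_comp; simpl.
  f_equal; apply proof_irrelevance.
- intros G H [U0 U1 p q]; unfold GFunctor_comp; simpl.
  f_equal; apply proof_irrelevance.
- intros G H K L W V U; unfold GFunctor_comp; simpl.
  f_equal; apply proof_irrelevance.
Defined.

Definition Grd_objects : Functor Grd Sets :=
  {| fob := gob : Grd -> Sets;
     fmap := fun G H (U : @hom Grd G H) => gfob U : @hom Sets (gob G) (gob H);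
     fmap_id := fun G => eq_refl;
     fmap_comp := fun G H K V U => eq_refl |}.

Definition Grd_over (X : Sets) : Category := fibre Grd_objects X.

(* Main.v *)
From Stdlib Require Import ProofIrrelevance FunctionalExtensionality.
Require Import Defs.

(** For groups, points over [Y] are groups equipped with an action of [Y],
    change of base along [h : W -> Y] restricts the action, and the right
    adjoint is coinduction.  The same happens in the fibre over [X].  A point
    [(p : E -> Y, t)] is determined by the groups of loops [k] of [E] with
    [p k = 1], on which [Y] acts through conjugation by [t]: it is a functor
    from [Y] to groups.  Change of base precomposes this functor with [h], so
    its right adjoint is the right Kan extension along [h].  As [h] is the
    identity on objects, the Kan extension of a point [(f : G -> W, s)] has as
    value at [y] the group of families [k w c : G w w], indexed by the objects
    [w] and the arrows [c : Y y w], such that [f (k w c) = 1] and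
    [k w' (h a c) s(a) = s(a) k w c] for all [a : W w w'].  These families form
    a small set, because [w] runs through the small set [X].

    The coinduced point is the semidirect product of [Y] with these groups
    ([coind_groupoid], [coind_pt]).  An arrow [a : x -> y] of [E] splits, for
    each [c : y -> w], into a vertical loop
    [shift c a = t(c) a t(c p(a))^-1] at [w] and an arrow in the image of [t].
    A morphism [phi] out of the restricted point therefore transposes to
    [a |-> (p a, c |-> phi (1, shift c a))], and a morphism [psi] into the
    coinduced point transposes back to [(a, d) |-> (psi d)(1) s(a)].  These two
    are inverse to each other ([coind_transposeK], [coind_untransposeK]).

    Objects of the fibre are groupoids whose set of objects is only
    propositionally equal to [X].  All computations are made on arrows indexed
    by the elements of [X], thanks to the facts that morphisms of the fibre
    amount to identity-on-objects assignments on these arrows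
    ([act_faithful], [act_full]) and that the arrows of an arbitrary pullback
    are pairs of arrows with the same image ([pb_arr], [pb_arr_ext]). *)

Set Implicit Arguments.
Unset Strict Implicit.
Unset Printing Implicit Defensive.

Local Open Scope cat_scope.

(** * Arrows of an object of the fibre, indexed by the elements of X *)

Definition vertex (X : Sets) (P : Grd_over X) : X -> gob (fib_ob P) :=
  match fib_over P in _ = X' return X' -> gob (fib_ob P) with
  | eq_refl => fun x => x
  end.

Definition arr (X : Sets) (P : Grd_over X) (x y : X) : SmallSet :=
  garr (fib_ob P) (vertex P x) (vertex P y).

Definition one (X : Sets) (P : Grd_over X) (x : X) : arr P x x :=
  gid (fib_ob P) (vertex P x).

Definition mul (X : Sets) (P : Grd_over X) (x y z : X)
  (b : arr P y z) (a : arr P x y) : arr P x z := gcomp b a.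

Definition inv (X : Sets) (P : Grd_over X) (x y : X) (a : arr P x y) :
  arr P y x := ginv a.

Notation "b '**' a" := (mul b a) (at level 40, left associativity).

Section Laws.
Variables (X : Sets) (P : Grd_over X).

Lemma mul1l x y (a : arr P x y) : one P y ** a = a.
Proof. apply gcomp_idl. Qed.

Lemma mul1r x y (a : arr P x y) : a ** one P x = a.
Proof. apply gcomp_idr. Qed.

Lemma mulA x y z w (c : arr P z w) (b : arr P y z) (a : arr P x y) :
  c ** (b ** a) = c ** b ** a.
Proof. apply gcomp_assoc. Qed.

Lemma mulVl x y (a : arr P x y) : inv a ** a = one P x.
Proof. apply gcomp_invl. Qed.

Lemma mulVr x y (a : arr P x y) : a ** inv a = one P y.
Proof. apply gcomp_invr. Qed.

Lemma mulKV x y z (b : arr P y z) (a : arr P x y) : b ** a ** inv a = b.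
Proof. now rewrite <- mulA, mulVr, mul1r. Qed.

Lemma mulVK x y z (b : arr P x z) (a : arr P x y) : b ** inv a ** a = b.
Proof. now rewrite <- mulA, mulVl, mul1r. Qed.

Lemma mulIr x y z (a : arr P x y) (b c : arr P y z) :
  b ** a = c ** a -> b = c.
Proof. intros e; now rewrite <- (mulKV b a), e, mulKV. Qed.

Lemma mul_eq_one_inv x y (b : arr P y x) (a : arr P x y) :
  b ** a = one P x -> b = inv a.
Proof. intros e; apply (@mulIr _ _ _ a); now rewrite e, mulVl. Qed.

Lemma inv_one x : inv (one P x) = one P x.
Proof. symmetry; apply mul_eq_one_inv, mul1l. Qed.

End Laws.

(** * Morphisms of the fibre as maps on indexed arrows *)

(** The equation [fib_hom_over] speaks of the transported functor; this is its
    consequence for the transported vertices.  It becomes the identity once the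
    equalities with [X] are eliminated. *)
Lemma fibre_hom_vertex (X : Sets) (P Q : Grd_over X) (u : hom P Q) (x : X) :
  gfob (fib_hom u) (vertex P x) = vertex Q x.
Proof.
destruct P as [G eG], Q as [H eH], u as [u e]; simpl in *.
unfold vertex; simpl.
generalize (equal_f e); clear e.
destruct eG; simpl; intros e.
specialize (e x); simpl in e; unfold comp in e; simpl in e.
revert e; generalize (gfob u x); clear u.
change (forall g : gob H,
  @eq_to_hom Sets (gob H) (gob G) eH g = x ->
  g = match eH in _ = X' return X' -> gob H with
      | eq_refl => fun x => x end x).
destruct eH; intros g e; exact e.
Qed.

Definition arr_cast (G : Groupoid) (x x' y y' : gob G)
  (ex : x = x') (ey : y = y') (a : garr G x y) : garr G x' y' :=
  match ex in _ = x', ey in _ = y' return garr G x' y' with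
  | eq_refl, eq_refl => a
  end.

Lemma arr_cast_loop (G : Groupoid) (x y : gob G) (ex : x = x) (ey : y = y)
  (a : garr G x y) : arr_cast ex ey a = a.
Proof.
now rewrite (proof_irrelevance _ ex eq_refl), (proof_irrelevance _ ey eq_refl).
Qed.

Definition act (X : Sets) (P Q : Grd_over X) (u : hom P Q) (x y : X)
  (a : arr P x y) : arr Q x y :=
  arr_cast (fibre_hom_vertex u x) (fibre_hom_vertex u y) (gfmap (fib_hom u) a).

Lemma act_one (X : Sets) (P Q : Grd_over X) (u : hom P Q) x :
  act u (one P x) = one Q x.
Proof.
unfold act, one, arr; rewrite gfmap_id.
now destruct (fibre_hom_vertex u x).
Qed.

Lemma act_mul (X : Sets) (P Q : Grd_over X) (u : hom P Q) x y z
  (b : arr P y z) (a : arr P x y) : act u (b ** a) = act u b ** act u a.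
Proof.
unfold act, mul, arr; rewrite gfmap_comp.
destruct (fibre_hom_vertex u x), (fibre_hom_vertex u y).
now destruct (fibre_hom_vertex u z).
Qed.

Lemma act_inv (X : Sets) (P Q : Grd_over X) (u : hom P Q) x y (a : arr P x y) :
  act u (inv a) = inv (act u a).
Proof. apply mul_eq_one_inv; now rewrite <- act_mul, mulVl, act_one. Qed.

Lemma act_idm (X : Sets) (P : Grd_over X) x y (a : arr P x y) : act (idm P) a = a.
Proof. exact (arr_cast_loop _ _ a). Qed.

Lemma act_comp (X : Sets) (P Q R : Grd_over X) (v : hom Q R) (u : hom P Q) x y
  (a : arr P x y) : act (v \oc u) a = act v (act u a).
Proof.
unfold act.
generalize (fibre_hom_vertex (v \oc u) x) (fibre_hom_vertex (v \oc u) y).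
generalize (fibre_hom_vertex v x) (fibre_hom_vertex v y).
simpl.
destruct (fibre_hom_vertex u x), (fibre_hom_vertex u y).
simpl; intros e1 e2 e3 e4.
now rewrite (proof_irrelevance _ e1 e3), (proof_irrelevance _ e2 e4).
Qed.

(** The object part of a morphism of the fibre is forced by
    [fibre_hom_vertex], so only its effect on arrows is left to compare. *)
Lemma act_faithful (X : Sets) (P Q : Grd_over X) (u v : hom P Q) :
  (forall x y (a : arr P x y), act u a = act v a) -> u = v.
Proof.
unfold act; intros e.
pose proof (fibre_hom_vertex u) as eu.
pose proof (fibre_hom_vertex v) as ev.
apply fibre_hom_eq.
assert (e' : forall x y p q p' q' (a : arr P x y),
  arr_cast p q (gfmap (fib_hom u) a) =
  arr_cast (x' := vertex Q x) (y' := vertex Q y) p' q' (gfmap (fib_hom v) a)).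
{ intros x y p q p' q' a; specialize (e x y a).
  now rewrite (proof_irrelevance _ p (fibre_hom_vertex u x)),
    (proof_irrelevance _ q (fibre_hom_vertex u y)),
    (proof_irrelevance _ p' (fibre_hom_vertex v x)),
    (proof_irrelevance _ q' (fibre_hom_vertex v y)). }
clear e.
destruct u as [u u1], v as [v v1]; simpl in *; clear u1 v1.
destruct P as [G eG]; unfold arr in e'; destruct eG; simpl in *.
change (forall x, gfob u x = vertex Q x) in eu.
change (forall x, gfob v x = vertex Q x) in ev.
change (forall x y p q p' q' (a : garr G x y),
  arr_cast p q (gfmap u a) =
  arr_cast (x' := vertex Q x) (y' := vertex Q y) p' q' (gfmap v a)) in e'.
destruct u as [u0 u1 u2 u3], v as [v0 v1 v2 v3]; simpl in *.
assert (u0 = v0) by (extensionality x; now rewrite eu, ev).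
subst v0.
assert (u1 = v1).
{ extensionality x; extensionality y; extensionality a.
  specialize (e' x y (eu x) (eu y) (eu x) (eu y) a).
  destruct (eu x), (eu y); exact e'. }
subst v1.
f_equal; apply proof_irrelevance.
Qed.

(** Elimination of the equality [gob P = X] lets the vertices of [P] serve as
    indices, so that [vertex Q] is the object part of the required functor. *)
Lemma act_full (X : Sets) (P Q : Grd_over X)
  (F : forall x y, arr P x y -> arr Q x y)
  (F1 : forall x, F x x (one P x) = one Q x)
  (FM : forall x y z (b : arr P y z) (a : arr P x y),
    F x z (b ** a) = F y z b ** F x y a) :
  {u : hom P Q | forall x y (a : arr P x y), act u a = F x y a}.
Proof.
destruct P as [G eG]; destruct eG.
set (U := {| gfob := vertex Q; gfmap := F; gfmap_id := F1; gfmap_comp := FM |}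
  : @hom Grd G (fib_ob Q)).
assert (e : eq_to_hom (fib_over Q) \oc fmap Grd_objects U
  = eq_to_hom (@eq_refl _ (Grd_objects G))).
{ subst U; simpl; clear F F1 FM; unfold vertex; extensionality x; simpl.
  destruct Q as [H eH]; simpl in *.
  revert x.
  change (forall x : gob G,
    @eq_to_hom Sets (gob H) (gob G) eH
      (match eH in _ = X' return X' -> gob H with
       | eq_refl => fun x => x end x) = x).
  now destruct eH. }
exists {| fib_hom := U
            : hom (fib_ob {| fib_ob := G; fib_over := eq_refl |}) (fib_ob Q);
          fib_hom_over := e |}.
intros x y a; exact (arr_cast_loop _ _ (F x y a)).
Qed.

Section OverHom.
Variables (X : Sets) (P Q : Grd_over X).
Variable F : forall x y, arr P x y -> arr Q x y.
Hypothesis F1 : forall x, F (one P x) = one Q x.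
Hypothesis FM : forall x y z (b : arr P y z) (a : arr P x y),
  F (b ** a) = F b ** F a.

Definition over_hom : hom P Q := proj1_sig (act_full F1 FM).

Lemma act_over_hom x y (a : arr P x y) : act over_hom a = F a.
Proof. exact (proj2_sig (act_full F1 FM) x y a). Qed.

End OverHom.

(** * Finite limits in the fibre *)

Definition point_groupoid (X : Sets) : Groupoid.
Proof.
refine {| gob := X; garr := fun _ _ => unit; gid := fun _ => tt;
          gcomp := fun _ _ _ _ _ => tt; ginv := fun _ _ _ => tt |};
  try reflexivity; now intros x y [].
Defined.

Lemma Grd_over_terminal (X : Sets) : inhabited (Terminal (Grd_over X)).
Proof.
set (T := {| fib_ob := point_groupoid X : Grd; fib_over := eq_refl |}
  : Grd_over X).
constructor; unshelve refine {| term_ob := T |}.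
- intros A; exact (@over_hom X A T (fun _ _ _ => tt)
    (fun _ => eq_refl) (fun _ _ _ _ _ => eq_refl)).
- intros A u; apply act_faithful; intros x y a.
  assert (e : forall b c : unit, b = c) by now intros [] [].
  apply e.
Qed.

Section FibreProduct.
Variables (X : Sets) (A B Z : Grd_over X) (f : hom A Z) (g : hom B Z).

Definition fprod_arr (x y : X) : SmallSet :=
  {p : arr A x y * arr B x y | act f (fst p) = act g (snd p)}.

Lemma fprod_arr_eq x y (p q : fprod_arr x y) :
  fst (proj1_sig p) = fst (proj1_sig q) ->
  snd (proj1_sig p) = snd (proj1_sig q) -> p = q.
Proof.
destruct p as [[a b] e], q as [[a' b'] e']; simpl; intros ea eb.
subst a' b'; f_equal; apply proof_irrelevance.
Qed.

Definition fprod_groupoid : Groupoid.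
Proof.
unshelve refine {|
  gob := X; garr := fprod_arr;
  gid := fun x => exist _ (one A x, one B x) _;
  gcomp := fun x y z q p =>
    exist _ (fst (proj1_sig q) ** fst (proj1_sig p),
             snd (proj1_sig q) ** snd (proj1_sig p)) _;
  ginv := fun x y p =>
    exist _ (inv (fst (proj1_sig p)), inv (snd (proj1_sig p))) _ |}.
- simpl; now rewrite !act_one.
- simpl; now rewrite !act_mul, (proj2_sig q), (proj2_sig p).
- simpl; now rewrite !act_inv, (proj2_sig p).
- intros; apply fprod_arr_eq; apply mul1l.
- intros; apply fprod_arr_eq; apply mul1r.
- intros; apply fprod_arr_eq; apply mulA.
- intros; apply fprod_arr_eq; apply mulVl.
- intros; apply fprod_arr_eq; apply mulVr.
Defined.

Definition fprod : Grd_over X :=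
  {| fib_ob := fprod_groupoid : Grd; fib_over := eq_refl |}.

Definition fprod_fst : hom fprod A :=
  @over_hom X fprod A (fun x y (p : fprod_arr x y) => fst (proj1_sig p))
    (fun _ => eq_refl) (fun _ _ _ _ _ => eq_refl).

Definition fprod_snd : hom fprod B :=
  @over_hom X fprod B (fun x y (p : fprod_arr x y) => snd (proj1_sig p))
    (fun _ => eq_refl) (fun _ _ _ _ _ => eq_refl).

Lemma act_fprod_fst x y (p : fprod_arr x y) :
  act (x := x) (y := y) fprod_fst p = fst (proj1_sig p).
Proof. apply act_over_hom. Qed.

Lemma act_fprod_snd x y (p : fprod_arr x y) :
  act (x := x) (y := y) fprod_snd p = snd (proj1_sig p).
Proof. apply act_over_hom. Qed.

Lemma fprod_square : f \oc fprod_fst = g \oc fprod_snd.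
Proof.
apply act_faithful; intros x y p.
rewrite !act_comp, act_fprod_fst, act_fprod_snd; exact (proj2_sig p).
Qed.

Section Pairing.
Variables (Q : Grd_over X) (a : hom Q A) (b : hom Q B).
Hypothesis e : f \oc a = g \oc b.

Lemma fprod_pair_eq x y (c : arr Q x y) : act f (act a c) = act g (act b c).
Proof. now rewrite <- !act_comp, e. Qed.

Definition fprod_pair : hom Q fprod.
Proof.
refine (@over_hom X Q fprod
  (fun x y c => exist _ (act a c, act b c) (fprod_pair_eq c)) _ _).
- intros; apply fprod_arr_eq; apply act_one.
- intros; apply fprod_arr_eq; apply act_mul.
Defined.

Lemma fprod_fst_pair : fprod_fst \oc fprod_pair = a.
Proof.
apply act_faithful; intros x y c.
rewrite act_comp, act_fprod_fst; unfold fprod_pair; now rewrite act_over_hom.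
Qed.

Lemma fprod_snd_pair : fprod_snd \oc fprod_pair = b.
Proof.
apply act_faithful; intros x y c.
rewrite act_comp, act_fprod_snd; unfold fprod_pair; now rewrite act_over_hom.
Qed.

End Pairing.

Definition fprod_pullback : Pullback f g.
Proof.
refine {| pb_square := fprod_square; pb_pair := fprod_pair;
          pb_pair_fst := fprod_fst_pair; pb_pair_snd := fprod_snd_pair |}.
intros Q u v e1 e2; apply act_faithful; intros x y c.
apply (@fprod_arr_eq x y).
- rewrite <- !act_fprod_fst; now rewrite <- !act_comp, e1.
- rewrite <- !act_fprod_snd; now rewrite <- !act_comp, e2.
Defined.

Variable pb : Pullback f g.

(** Any pullback receives the comparison map from the explicit fibre product;
    its values on pairs are the arrows of that pullback.  Change of base is
    built from an arbitrary choice of pullbacks, hence this detour. *)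
Definition pb_arr x y (a : arr A x y) (b : arr B x y)
  (e : act f a = act g b) : arr (pb_ob pb) x y :=
  act (pb_pair pb fprod_square) (exist _ (a, b) e : arr fprod x y).

Lemma fst_pb_arr x y (a : arr A x y) (b : arr B x y) (e : act f a = act g b) :
  act (pb_fst pb) (pb_arr e) = a.
Proof. unfold pb_arr; now rewrite <- act_comp, pb_pair_fst, act_fprod_fst. Qed.

Lemma snd_pb_arr x y (a : arr A x y) (b : arr B x y) (e : act f a = act g b) :
  act (pb_snd pb) (pb_arr e) = b.
Proof. unfold pb_arr; now rewrite <- act_comp, pb_pair_snd, act_fprod_snd. Qed.

Lemma pb_arr_ext x y (p q : arr (pb_ob pb) x y) :
  act (pb_fst pb) p = act (pb_fst pb) q ->
  act (pb_snd pb) p = act (pb_snd pb) q -> p = q.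
Proof.
intros e1 e2.
set (r := fprod_pair (pb_square pb)).
assert (rK : pb_pair pb fprod_square \oc r = idm _).
{ apply (pb_ext (p := pb)); rewrite comp_assoc, comp_idr.
  - rewrite pb_pair_fst; apply fprod_fst_pair.
  - rewrite pb_pair_snd; apply fprod_snd_pair. }
rewrite <- (act_idm p), <- (act_idm q), <- rK, !act_comp; f_equal.
unfold r, fprod_pair; rewrite !act_over_hom; now apply fprod_arr_eq.
Qed.

End FibreProduct.

Lemma Grd_over_finitely_complete (X : Sets) : finitely_complete (Grd_over X).
Proof.
split; [apply Grd_over_terminal|].
constructor; exact (fun A B Z f g => fprod_pullback f g).
Qed.

(** * Points on arrows *)

Lemma pth_map_act (X : Sets) (V : Grd_over X) (P Q : Pt V) (u : hom P Q) x y
  (a : arr (pt_dom P) x y) : act (pt_map Q) (act (pth u) a) = act (pt_map P) a.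
Proof. now rewrite <- act_comp, pth_map. Qed.

Lemma pth_sec_act (X : Sets) (V : Grd_over X) (P Q : Pt V) (u : hom P Q) x y
  (a : arr V x y) : act (pth u) (act (pt_sec P) a) = act (pt_sec Q) a.
Proof. now rewrite <- act_comp, pth_sec. Qed.

Lemma pt_split_act (X : Sets) (V : Grd_over X) (P : Pt V) x y (a : arr V x y) :
  act (pt_map P) (act (pt_sec P) a) = a.
Proof. now rewrite <- act_comp, pt_split, act_idm. Qed.

(** * The coinduced point *)

Section Coinduction.
Variables (X : Sets) (W Y : Grd_over X) (h : hom W Y).

Section CoinducedPoint.
Variable B : Pt W.

(** The semidirect product of [Y] with the pointwise Kan extension: an arrow
    [x -> y] is an arrow of [Y] together with an element of the limit at its
    target [y].  Equivariance is written without inverses; it says that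
    conjugation by [s(a)] takes [family c] to [family (h a ** c)]. *)
Record coind_arr (x y : X) := {
  base : arr Y x y;
  family : forall w, arr Y y w -> arr (pt_dom B) w w;
  family_vertical : forall w (c : arr Y y w),
    act (pt_map B) (family c) = one W w;
  family_equivariant : forall w w' (a : arr W w w') (c : arr Y y w),
    family (act h a ** c) ** act (pt_sec B) a = act (pt_sec B) a ** family c
}.

Lemma coind_arr_eq x y (p q : coind_arr x y) :
  base p = base q ->
  (forall w (c : arr Y y w), family p c = family q c) -> p = q.
Proof.
destruct p as [b k e1 e2], q as [b' k' e1' e2']; simpl; intros eb ek.
assert (k = k') by (extensionality w; extensionality c; apply ek).
subst b' k'; f_equal; apply proof_irrelevance.
Qed.

Definition coind_sec_arr x y (b : arr Y x y) : coind_arr x y.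
Proof.
refine {| base := b; family := fun w c => one (pt_dom B) w |}.
- intros; apply act_one.
- intros; now rewrite mul1l, mul1r.
Defined.

(** In a semidirect product, [(b, k)(b', k') = (b b', k (b . k'))]; here [Y]
    acts on families by precomposition, [(b . k') c = k' (c b)]. *)
Definition coind_mul x y z (q : coind_arr y z) (p : coind_arr x y) :
  coind_arr x z.
Proof.
refine {| base := base q ** base p;
          family := fun w c => family q c ** family p (c ** base q) |}.
- intros; now rewrite act_mul, !family_vertical, mul1l.
- intros; rewrite <- !mulA, family_equivariant, !mulA.
  now rewrite <- family_equivariant.
Defined.

Definition coind_inv x y (p : coind_arr x y) : coind_arr y x.
Proof.
refine {| base := inv (base p);
          family := fun w c => inv (family p (c ** inv (base p))) |}.
- intros; rewrite act_inv, family_vertical; symmetry.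
  apply mul_eq_one_inv, mul1l.
- intros w w' a c.
  apply (@mulIr _ _ _ _ _ (family p (c ** inv (base p)))).
  rewrite mulVK, <- mulA, <- family_equivariant, !mulA, mulVl, mul1l.
  reflexivity.
Defined.

Definition coind_groupoid : Groupoid.
Proof.
refine {| gob := X; garr := coind_arr;
          gid := fun x => coind_sec_arr (one Y x);
          gcomp := coind_mul; ginv := coind_inv |};
  intros; apply coind_arr_eq; simpl; intros.
- apply mul1l.
- now rewrite mul1l, mul1r.
- apply mul1r.
- apply mul1r.
- apply mulA.
- now rewrite !mulA.
- apply mulVl.
- apply mulVl.
- apply mulVr.
- now rewrite mulKV, mulVr.
Defined.

Definition coind_ob : Grd_over X :=
  {| fib_ob := coind_groupoid : Grd; fib_over := eq_refl |}.

Definition coind_map : hom coind_ob Y :=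
  @over_hom X coind_ob Y (fun x y (p : coind_arr x y) => base p)
    (fun _ => eq_refl) (fun _ _ _ _ _ => eq_refl).

Lemma act_coind_map x y (p : coind_arr x y) :
  act (x := x) (y := y) coind_map p = base p.
Proof. apply act_over_hom. Qed.

Definition coind_sec : hom Y coind_ob.
Proof.
refine (@over_hom X Y coind_ob coind_sec_arr (fun _ => eq_refl) _).
intros; apply coind_arr_eq; simpl; [reflexivity|].
intros; now rewrite mul1l.
Defined.

Lemma act_coind_sec x y (b : arr Y x y) : act coind_sec b = coind_sec_arr b.
Proof. apply act_over_hom. Qed.

Definition coind_pt : Pt Y.
Proof.
refine {| pt_map := coind_map; pt_sec := coind_sec |}.
apply act_faithful; intros x y b.
now rewrite act_comp, act_coind_sec, act_coind_map, act_idm.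
Defined.

End CoinducedPoint.

(** * Functoriality of coinduction *)

Definition coind_push_arr (B B' : Pt W) (u : hom B B') x y
  (p : coind_arr B x y) : coind_arr B' x y.
Proof.
refine {| base := base p; family := fun w c => act (pth u) (family p c) |}.
- intros; now rewrite pth_map_act, family_vertical.
- intros; rewrite <- (pth_sec_act u), <- !act_mul.
  now rewrite family_equivariant.
Defined.

Definition coind_push (B B' : Pt W) (u : hom B B') :
  hom (coind_ob B) (coind_ob B').
Proof.
refine (@over_hom X (coind_ob B) (coind_ob B')
  (fun x y p => coind_push_arr u p) _ _);
  intros; apply coind_arr_eq; try reflexivity; intros w c; simpl.
- apply act_one.
- apply act_mul.
Defined.

Lemma act_coind_push (B B' : Pt W) (u : hom B B') x y
  (p : coind_arr B x y) :
  act (x := x) (y := y) (coind_push u) p = coind_push_arr u p.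
Proof. unfold coind_push; now rewrite act_over_hom. Qed.

Definition coind_hom (B B' : Pt W) (u : hom B B') :
  hom (coind_pt B) (coind_pt B').
Proof.
refine {| pth := coind_push u
            : hom (pt_dom (coind_pt B)) (pt_dom (coind_pt B')) |};
  apply act_faithful; intros x y p; rewrite act_comp; simpl.
- rewrite act_coind_push; now rewrite !act_coind_map.
- rewrite !act_coind_sec, act_coind_push; apply coind_arr_eq; [reflexivity|].
  intros; apply act_one.
Defined.

Definition coinduction : Functor (Pt W) (Pt Y).
Proof.
refine {| fob := coind_pt; fmap := coind_hom |}.
- intros B; apply Pt_hom_eq, act_faithful; intros x y p; simpl.
  rewrite act_coind_push, act_idm; apply coind_arr_eq; [reflexivity|].
  intros; apply act_idm.
- intros B B' B'' v u; apply Pt_hom_eq, act_faithful; intros x y p.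
  change (act (coind_push (v \oc u)) p
    = act (coind_push v \oc coind_push u) p).
  rewrite act_comp, !act_coind_push; apply coind_arr_eq; [reflexivity|].
  intros; apply act_comp.
Defined.

(** * The adjunction between change of base and coinduction *)

Variable pb : Pullbacks (Grd_over X).
Notation restriction := (base_change pb h).

Section Bijection.
Variables (A : Pt Y) (B : Pt W).

(** The component of [a] along the kernel of the point, moved to the vertex
    [w] by conjugation with the section at [c].  In the action notation it is
    [c . (a t(p a)^-1)], rewritten so as to use one inverse only. *)
Definition shift x y w (c : arr Y y w) (a : arr (pt_dom A) x y) :
  arr (pt_dom A) w w :=
  act (pt_sec A) c ** a ** inv (act (pt_sec A) (c ** act (pt_map A) a)).

Lemma shift_vertical x y w (c : arr Y y w) (a : arr (pt_dom A) x y) :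
  act (pt_map A) (shift c a) = one Y w.
Proof.
unfold shift; now rewrite !act_mul, act_inv, !act_mul, !pt_split_act, mulVr.
Qed.

(** The cocycle identity that matches the multiplication of [coind_mul]; it is
    what makes the transpose a functor. *)
Lemma shift_mul x y z w (c : arr Y z w) (b : arr (pt_dom A) y z)
  (a : arr (pt_dom A) x y) :
  shift c (b ** a) = shift c b ** shift (c ** act (pt_map A) b) a.
Proof.
unfold shift; now rewrite (act_mul (pt_map A)), !mulA, mulVK.
Qed.

Lemma shift_sec x y w (c : arr Y y w) (b : arr Y x y) :
  shift c (act (pt_sec A) b) = one _ w.
Proof. unfold shift; now rewrite pt_split_act, act_mul, mulVr. Qed.

(** This is the equivariance required from the families of [coind_arr]. *)
Lemma shift_conj x y w w' (d : arr Y w w') (c : arr Y y w)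
  (a : arr (pt_dom A) x y) :
  shift (d ** c) a ** act (pt_sec A) d = act (pt_sec A) d ** shift c a.
Proof.
unfold shift; rewrite <- (mulA d), !(act_mul (pt_sec A) d).
set (s := act _ d).
apply (@mulIr _ _ _ _ _ (act (pt_sec A) (c ** act (pt_map A) a))).
rewrite <- (mulA _ s), mulVK.
now rewrite <- (mulA s _ (act _ _)), mulVK, mulA.
Qed.

(** At [c = 1] the splitting of [a] into a loop of the kernel and an arrow of
    the section recovers [a]; this makes transposition injective. *)
Lemma shift_trivial x y (a : arr (pt_dom A) x y) :
  shift (one Y y) a ** act (pt_sec A) (act (pt_map A) a) = a.
Proof. unfold shift; now rewrite act_one, !mul1l, mulVK. Qed.

Notation pbA := (pb h (pt_map A)).

Lemma kernel_arr_eq w (k : arr (pt_dom A) w w) :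
  act (pt_map A) k = one Y w -> act h (one W w) = act (pt_map A) k.
Proof. intros e; now rewrite e, act_one. Qed.

(** A loop in the kernel of [A] gives the pair [(1, k)] in the pullback: change
    of base leaves kernels as they are. *)
Definition kernel_arr w (k : arr (pt_dom A) w w)
  (e : act (pt_map A) k = one Y w) : arr (pt_dom (restriction A)) w w :=
  pb_arr pbA (kernel_arr_eq e).

(** The projections of the pullback are given types that mention
    [pt_dom (restriction A)], so that rewriting does not have to identify it
    with the underlying pullback object. *)
Definition restr_fst : hom (pt_dom (restriction A)) W := pb_fst pbA.
Definition restr_snd : hom (pt_dom (restriction A)) (pt_dom A) := pb_snd pbA.

Lemma restriction_arr_ext x y (d e : arr (pt_dom (restriction A)) x y) :
  act restr_fst d = act restr_fst e -> act restr_snd d = act restr_snd e -> d = e.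
Proof. apply pb_arr_ext. Qed.

Lemma restr_fst_kernel w (k : arr (pt_dom A) w w)
  (e : act (pt_map A) k = one Y w) : act restr_fst (kernel_arr e) = one W w.
Proof. apply fst_pb_arr. Qed.

Lemma restr_snd_kernel w (k : arr (pt_dom A) w w)
  (e : act (pt_map A) k = one Y w) : act restr_snd (kernel_arr e) = k.
Proof. apply snd_pb_arr. Qed.

Lemma restr_fst_sec x y (a : arr W x y) :
  act restr_fst (act (pt_sec (restriction A)) a) = a.
Proof. exact (pt_split_act (restriction A) a). Qed.

Lemma restr_snd_sec x y (a : arr W x y) :
  act restr_snd (act (pt_sec (restriction A)) a) = act (pt_sec A) (act h a).
Proof.
rewrite <- !act_comp.
change (act (pb_snd pbA \oc pb_pair pbA (base_change_sec_eq h A)) a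
  = act (pt_sec A \oc h) a).
now rewrite pb_pair_snd.
Qed.

Lemma act_restriction_map x y (e : arr (pt_dom (restriction A)) x y) :
  act (pt_map (restriction A)) e = act restr_fst e.
Proof. reflexivity. Qed.

Lemma restriction_square x y (e : arr (pt_dom (restriction A)) x y) :
  act (pt_map A) (act restr_snd e) = act h (act restr_fst e).
Proof.
assert (e' : h \oc restr_fst = pt_map A \oc restr_snd) by exact (pb_square pbA).
now rewrite <- !act_comp, e'.
Qed.

Section Transpose.
Variable phi : hom (restriction A) B.

(** The family attached to [a] is [c |-> phi (1, shift c a)]. *)
Definition transpose_arr x y (a : arr (pt_dom A) x y) : coind_arr B x y.
Proof.
refine {| base := act (pt_map A) a;
          family := fun w c => act (pth phi) (kernel_arr (shift_vertical c a))
       |}.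
- intros w c; rewrite pth_map_act, act_restriction_map.
  apply restr_fst_kernel.
- intros w w' d c; rewrite <- (pth_sec_act phi), <- !act_mul; f_equal.
  apply restriction_arr_ext; rewrite !act_mul.
  + rewrite restr_fst_sec, !restr_fst_kernel.
    now rewrite mul1l, mul1r.
  + rewrite restr_snd_sec, !restr_snd_kernel.
    apply shift_conj.
Defined.

Lemma transpose_arr_one x :
  transpose_arr (one (pt_dom A) x) = coind_sec_arr B (one Y x).
Proof.
apply coind_arr_eq; simpl; [apply act_one|].
intros w c; rewrite <- (act_one (pth phi)); f_equal.
apply restriction_arr_ext; rewrite act_one.
- apply restr_fst_kernel.
- rewrite restr_snd_kernel, <- (act_one (pt_sec A)); apply shift_sec.
Qed.

Lemma transpose_arr_mul x y z (b : arr (pt_dom A) y z)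
  (a : arr (pt_dom A) x y) :
  transpose_arr (b ** a) = coind_mul (transpose_arr b) (transpose_arr a).
Proof.
apply coind_arr_eq; simpl; [apply act_mul|].
intros w c; rewrite <- act_mul; f_equal.
apply restriction_arr_ext; rewrite act_mul.
- now rewrite !restr_fst_kernel, mul1l.
- rewrite !restr_snd_kernel; apply shift_mul.
Qed.

Definition transpose_over : hom (pt_dom A) (coind_ob B) :=
  @over_hom X (pt_dom A) (coind_ob B) transpose_arr
    transpose_arr_one transpose_arr_mul.

Lemma act_transpose_over x y (a : arr (pt_dom A) x y) :
  act transpose_over a = transpose_arr a.
Proof. apply act_over_hom. Qed.

Definition coind_transpose : hom A (coinduction B).
Proof.
refine {| pth := transpose_over
            : hom (pt_dom A) (pt_dom (coinduction B)) |};
  apply act_faithful; intros x y a; rewrite act_comp; simpl.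
- now rewrite act_transpose_over, act_coind_map.
- rewrite act_transpose_over, act_coind_sec.
  apply coind_arr_eq; simpl; [apply pt_split_act|].
  intros w c; rewrite <- (act_one (pth phi)); f_equal.
  apply restriction_arr_ext; rewrite act_one.
  + apply restr_fst_kernel.
  + rewrite restr_snd_kernel; apply shift_sec.
Defined.

End Transpose.

Section Untranspose.
Variable psi : hom A (coinduction B).

(** The arrow map of [psi], typed so that the components of its values are
    accessible. *)
Definition adjunct_arr x y (a : arr (pt_dom A) x y) : coind_arr B x y :=
  act (pth psi) a.

Lemma base_adjunct_arr x y (a : arr (pt_dom A) x y) :
  base (adjunct_arr a) = act (pt_map A) a.
Proof. rewrite <- (pth_map_act psi); symmetry; apply act_coind_map. Qed.

Lemma adjunct_arr_one x : adjunct_arr (one _ x) = coind_sec_arr B (one Y x).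
Proof. exact (act_one (pth psi) x). Qed.

Lemma adjunct_arr_mul x y z (b : arr (pt_dom A) y z) (a : arr (pt_dom A) x y) :
  adjunct_arr (b ** a) = coind_mul (adjunct_arr b) (adjunct_arr a).
Proof. exact (act_mul (pth psi) b a). Qed.

Lemma adjunct_arr_inv x y (a : arr (pt_dom A) x y) :
  adjunct_arr (inv a) = coind_inv (adjunct_arr a).
Proof. exact (act_inv (pth psi) a). Qed.

Lemma adjunct_arr_sec x y (b : arr Y x y) :
  adjunct_arr (act (pt_sec A) b) = coind_sec_arr B b.
Proof.
transitivity (act (coind_sec B) b); [|apply act_coind_sec].
exact (pth_sec_act psi b).
Qed.

(** The counit evaluates a family at the identity of its vertex; the arrow
    [act (pt_sec B)] restores the part of the arrow that lies over [W]. *)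
Definition untranspose_arr x y (e : arr (pt_dom (restriction A)) x y) :
  arr (pt_dom B) x y :=
  family (adjunct_arr (act restr_snd e)) (one Y y)
  ** act (pt_sec B) (act restr_fst e).

Lemma untranspose_arr_one x :
  untranspose_arr (one _ x) = one (pt_dom B) x.
Proof.
unfold untranspose_arr; rewrite !act_one, adjunct_arr_one; apply mul1l.
Qed.

(** Multiplication in [coind_arr] evaluates the second family at [h a] rather
    than at an identity; equivariance moves that [h a] across [s(a)]. *)
Lemma untranspose_arr_mul x y z (e' : arr (pt_dom (restriction A)) y z)
  (e : arr (pt_dom (restriction A)) x y) :
  untranspose_arr (e' ** e) = untranspose_arr e' ** untranspose_arr e.
Proof.
unfold untranspose_arr; rewrite !act_mul, adjunct_arr_mul; simpl.
rewrite base_adjunct_arr, restriction_square, mul1l.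
rewrite <- (mul1r (act h _)), <- !mulA; f_equal.
now rewrite !mulA, family_equivariant.
Qed.

Definition untranspose_over : hom (pt_dom (restriction A)) (pt_dom B) :=
  over_hom untranspose_arr_one untranspose_arr_mul.

Lemma act_untranspose_over x y (e : arr (pt_dom (restriction A)) x y) :
  act untranspose_over e = untranspose_arr e.
Proof. apply act_over_hom. Qed.

Definition coind_untranspose : hom (restriction A) B.
Proof.
refine {| pth := untranspose_over |};
  apply act_faithful; intros x y a;
  rewrite act_comp, act_untranspose_over; unfold untranspose_arr.
- now rewrite act_mul, family_vertical, mul1l, pt_split_act.
- rewrite restr_fst_sec, restr_snd_sec, adjunct_arr_sec.
  apply mul1l.
Defined.

End Untranspose.

(** An arrow [(a, d)] of the pullback is [(1, shift 1 d)] times the value of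
    the section at [a], and [phi] preserves both the product and the section. *)
Lemma coind_transposeK (phi : hom (restriction A) B) :
  coind_untranspose (coind_transpose phi) = phi.
Proof.
apply Pt_hom_eq, act_faithful; intros x y e.
change (act (untranspose_over (coind_transpose phi)) e = act (pth phi) e).
rewrite act_untranspose_over; unfold untranspose_arr, adjunct_arr.
change (act (pth (coind_transpose phi)) (act restr_snd e))
  with (act (transpose_over phi) (act restr_snd e)).
rewrite act_transpose_over; simpl.
rewrite <- (pth_sec_act phi), <- act_mul; f_equal.
apply restriction_arr_ext; rewrite act_mul.
- now rewrite restr_fst_sec, restr_fst_kernel, mul1l.
- rewrite restr_snd_sec, restr_snd_kernel, <- restriction_square.
  apply shift_trivial.
Qed.

(** The image of [shift c a] under [psi] is [psi a] multiplied by arrows of the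
    section of the coinduced point, whose families are trivial; evaluation at
    the identity then returns the family of [psi a] at [c]. *)
Lemma coind_untransposeK (psi : hom A (coinduction B)) :
  coind_transpose (coind_untranspose psi) = psi.
Proof.
apply Pt_hom_eq, act_faithful; intros x y a.
change (act (transpose_over (coind_untranspose psi)) a = adjunct_arr psi a).
rewrite act_transpose_over; apply coind_arr_eq; simpl.
- now rewrite base_adjunct_arr.
- intros w c; rewrite act_untranspose_over; unfold untranspose_arr.
  rewrite restr_snd_kernel, restr_fst_kernel, act_one, mul1r.
  unfold shift; rewrite !adjunct_arr_mul, adjunct_arr_inv, !adjunct_arr_sec; simpl.
  now rewrite !mul1l, inv_one, mul1r.
Qed.

End Bijection.

Section Naturality.
Variables (A A' : Pt Y) (a : hom A' A).

Lemma restr_fst_restriction x y (e : arr (pt_dom (restriction A')) x y) :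
  act (restr_fst A) (act (pth (fmap restriction a)) e) = act (restr_fst A') e.
Proof. exact (pth_map_act (fmap restriction a) e). Qed.

Lemma restr_snd_restriction x y (e : arr (pt_dom (restriction A')) x y) :
  act (restr_snd A) (act (pth (fmap restriction a)) e)
  = act (pth a) (act (restr_snd A') e).
Proof.
assert (e' : restr_snd A \oc pth (fmap restriction a) = pth a \oc restr_snd A')
  by apply pb_pair_snd.
now rewrite <- !act_comp, e'.
Qed.

(** Morphisms of points preserve map and section, hence everything [shift] is
    made of; naturality of the transpose in [A] follows. *)
Lemma act_shift x y w (d : arr Y y w) (c : arr (pt_dom A') x y) :
  act (pth a) (shift d c) = shift d (act (pth a) c).
Proof.
unfold shift; now rewrite !act_mul, act_inv, !act_mul, !pth_sec_act, pth_map_act.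
Qed.

End Naturality.

Lemma coind_transpose_natural (A A' : Pt Y) (B B' : Pt W) (a : hom A' A)
  (f : hom (restriction A) B) (b : hom B B') :
  coind_transpose (b \oc f \oc fmap restriction a)
  = fmap coinduction b \oc coind_transpose f \oc a.
Proof.
apply Pt_hom_eq, act_faithful; intros x y c.
change (act (transpose_over (b \oc f \oc fmap restriction a)) c
  = act (coind_push b \oc transpose_over f \oc pth a) c).
rewrite !act_comp, !act_transpose_over, act_coind_push.
apply coind_arr_eq; simpl; [now rewrite pth_map_act|].
intros w d.
transitivity (act (pth b) (act (pth f)
  (act (pth (fmap restriction a)) (kernel_arr (shift_vertical d c))))).
{ rewrite <- !act_comp; reflexivity. }
do 2 f_equal; apply restriction_arr_ext.
- now rewrite restr_fst_restriction, !restr_fst_kernel.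
- rewrite restr_snd_restriction, !restr_snd_kernel; apply act_shift.
Qed.

Lemma restriction_coinduction_adjoint :
  has_right_adjoint restriction.
Proof.
exists coinduction; constructor.
exact {| transpose := coind_transpose; untranspose := coind_untranspose;
         transposeK := coind_transposeK; untransposeK := coind_untransposeK;
         transpose_natural := coind_transpose_natural |}.
Qed.

End Coinduction.

Theorem theorem2p5 (X : Sets) :
  locally_algebraically_cartesian_closed (Grd_over X).
Proof.
split; [apply Grd_over_finitely_complete|].
intros pb W Y h; exact (restriction_coinduction_adjoint h pb).
Qed.
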